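(* Let $p$ be a prime, let $r$ be a positive integer, let $A\in M_{r\times r}(\mathbb{Z})$ be a non-singular matrix, let $\chi_A(x)$ be the characteristic polynomial of $A$, let $\chi_A^1(x)$ be the unit root factor of $\chi_A(x)$ (with respect to $\mathbb{Z}_p$), and let $G=\bigcup_{n=0}^\infty A^{-n}(\mathbb{Z}^r)\subseteq\mathbb{Q}^r$. Then $$G^{*p}=\{w\in(\mathbb{Z}_p^r)^* : w\,\chi_A^1(A)=0\}.$$
   Context: $\mathbb{Z}_p^r$ denotes $r\times 1$ columns and $(\mathbb{Z}_p^r)^*$ denotes $1\times r$ rows with entries in the $p$-adic integers $\mathbb{Z}_p$. Non-singular means non-zero determinant. Unit root factor: let $f\in\mathbb{Z}_p[x]$ be monic, let $K$ be the splitting field of $f$ over $\mathbb{Q}_p$, let $|\cdot|_\pi$ be the absolute value on $K$ with respect to a uniformizing parameter $\pi$ of the ring of integers of $K$, and let $z_1,\dots,z_r$ be the roots of $f$ in $K$ listed with multiplicity. The unit root factor of $f$ is $f^1(x)=\prod_{\{i : |z_i|_\pi=1\}}(x-z_i)$ (an empty product being $1$). It is known that $f^1\in\mathbb{Q}_p[x]$. Here it is applied to $f=\chi_A$, regarded as a polynomial over $\mathbb{Z}_p$. For a torsion-free abelian group $G$, $G^{*p}=\mathrm{Hom}(G,\mathbb{Z}_p)$ is the group of all group homomorphisms from $G$ to $\mathbb{Z}_p$. Since $\mathbb{Z}^r\subseteq G\subseteq\mathbb{Q}^r$, each such homomorphism has the form $g\mapsto wg$ for a unique row $w\in(\mathbb{Z}_p^r)^*$,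 and $G^{*p}$ is identified with the set of rows $w\in(\mathbb{Z}_p^r)^*$ such that $wg\in\mathbb{Z}_p$ for all $g\in G$. *)

(* Defs.v *)
From HB Require Import structures.
From mathcomp Require Import all_boot all_order all_algebra all_field.
From mathcomp Require Import boolp classical_sets reals.

Set Implicit Arguments.
Unset Strict Implicit.
Unset Printing Implicit Defensive.

Import Order.TTheory GRing.Theory Num.Theory.
Local Open Scope ring_scope.
Local Open Scope classical_set_scope.

(* Z_p is the inverse limit of the rings Z/p^n.  An element is the sequence of
   its residues, the n-th one being an integer in [0, p^n): the range condition
   is implied by the equation residueP.  The proof of primality is a parameter
   because the integral domain structure (hence Q_p) depends on it. *)
Record padicZ (p : nat) (p_pr : prime p) := PadicZ {
  residue :> nat -> int;
  residueP : forall n, residue n = (residue n.+1 %% (p ^ n)%:Z)%Z }.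

HB.instance Definition _ (p : nat) (p_pr : prime p) :=
  gen_eqMixin (padicZ p_pr).
HB.instance Definition _ (p : nat) (p_pr : prime p) :=
  gen_choiceMixin (padicZ p_pr).

Section PadicIntegers.
Variables (p : nat) (p_pr : prime p).
Local Notation Zp := (padicZ p_pr).
Local Notation q n := ((p ^ n)%N%:Z).
Implicit Types (x y z : Zp) (n m : nat) (u v : nat -> int).

Lemma padicZ_ext x y : (forall n, x n = y n) -> x = y.
Proof.
case: x y => [x hx] [y hy] /= /funext exy; rewrite exy in hx *.
by congr PadicZ; apply: Prop_irrelevance.
Qed.

Lemma residue_mod x n : (x n %% q n)%Z = x n.
Proof. by rewrite residueP modz_mod. Qed.

Lemma modz_dvd_mod (m d e : int) : (d %| e)%Z -> ((m %% e)%Z = m %[mod d])%Z.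
Proof.
by case/dvdzP=> k ->; rewrite {2}(divz_eq m (k * d)) mulrA modzMDl.
Qed.

Lemma q_dvdS n : (q n %| q n.+1)%Z.
Proof. by rewrite dvdzE /= dvdn_exp2l. Qed.

Definition reduce_spec u :=
  forall n, (u n = u n.+1 %[mod q n])%Z.

Lemma reduceP u : reduce_spec u ->
  forall n, (u n %% q n)%Z = ((u n.+1 %% q n.+1)%Z %% q n)%Z.
Proof. by move=> hu n; rewrite modz_dvd_mod ?q_dvdS // hu. Qed.

Definition reduce u (hu : reduce_spec u) : Zp := PadicZ p_pr (reduceP hu).

Lemma residue_modS x n : (x n = x n.+1 %[mod q n])%Z.
Proof. by rewrite residueP modz_mod. Qed.

Lemma padic_const_subproof (a : int) : reduce_spec (fun=> a).
Proof. by []. Qed.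
Lemma padic_add_subproof x y : reduce_spec (fun n => x n + y n).
Proof.
by move=> n; rewrite -modzDm (residue_modS x) (residue_modS y) modzDm.
Qed.
Lemma padic_opp_subproof x : reduce_spec (fun n => - x n).
Proof. by move=> n; rewrite -modzNm (residue_modS x) modzNm. Qed.
Lemma padic_mul_subproof x y : reduce_spec (fun n => x n * y n).
Proof.
by move=> n; rewrite -modzMm (residue_modS x) (residue_modS y) modzMm.
Qed.

Definition padic_const (a : int) : Zp := reduce (padic_const_subproof a).
Definition padic_add x y : Zp := reduce (padic_add_subproof x y).
Definition padic_opp x : Zp := reduce (padic_opp_subproof x).
Definition padic_mul x y : Zp := reduce (padic_mul_subproof x y).

Lemma padic_addA : associative padic_add.
Proof.
by move=> x y z; apply: padicZ_ext => n /=; rewrite modzDmr modzDml addrA.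
Qed.
Lemma padic_addC : commutative padic_add.
Proof. by move=> x y; apply: padicZ_ext => n /=; rewrite addrC. Qed.
Lemma padic_add0 : left_id (padic_const 0) padic_add.
Proof.
by move=> x; apply: padicZ_ext => n /=; rewrite modzDml add0r residue_mod.
Qed.
Lemma padic_addN : left_inverse (padic_const 0) padic_opp padic_add.
Proof.
by move=> x; apply: padicZ_ext => n /=; rewrite modzDml addNr.
Qed.

HB.instance Definition _ := GRing.isZmodule.Build Zp
  padic_addA padic_addC padic_add0 padic_addN.

Lemma padic_mulA : associative padic_mul.
Proof.
by move=> x y z; apply: padicZ_ext => n /=; rewrite modzMmr modzMml mulrA.
Qed.
Lemma padic_mulC : commutative padic_mul.
Proof. by move=> x y; apply: padicZ_ext => n /=; rewrite mulrC. Qed.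
Lemma padic_mul1 : left_id (padic_const 1) padic_mul.
Proof.
by move=> x; apply: padicZ_ext => n /=; rewrite modzMml mul1r residue_mod.
Qed.
Lemma padic_mulD : left_distributive padic_mul padic_add.
Proof.
by move=> x y z; apply: padicZ_ext => n /=; rewrite modzMml modzDm mulrDl.
Qed.
Lemma padic_1neq0 : padic_const 1 != padic_const 0.
Proof.
apply/eqP => /(congr1 (fun x : Zp => x 1%N)) /=.
rewrite expn1 !modz_nat mod0n modn_small ?prime_gt1 //.
Qed.

HB.instance Definition _ := GRing.Zmodule_isComNzRing.Build Zp
  padic_mulA padic_mulC padic_mul1 padic_mulD padic_1neq0.

Definition padic_unit : {pred Zp} := fun x => `[< exists y, y * x = 1 >].
Definition padic_inv x : Zp :=
  if padic_unit x then xget x [set y | y * x = 1] else x.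

Lemma padic_mulV : {in padic_unit, left_inverse 1 padic_inv *%R}.
Proof.
move=> x ux; have {}ux : padic_unit x by [].
rewrite /padic_inv ux.
by case: xgetP => [y -> //|nex]; case/asboolP: ux => y /nex.
Qed.
Lemma padic_unitP x y : y * x = 1 -> padic_unit x.
Proof. by move=> xy; apply/asboolP; exists y. Qed.
Lemma padic_inv_out : {in [predC padic_unit], padic_inv =1 id}.
Proof.
move=> x nux; have {}nux : ~~ padic_unit x by [].
by rewrite /padic_inv (negbTE nux).
Qed.

HB.instance Definition _ := GRing.ComNzRing_hasMulInverse.Build Zp
  padic_mulV padic_unitP padic_inv_out.

Lemma residue_dvd x n m : (q n %| x (m + n)%N)%Z = (x n == 0).
Proof.
have e: (x n = x (m + n)%N %[mod q n])%Z.
  elim: m => //= m ->; have := residue_modS x (m + n).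
  move/(congr1 (fun a => (a %% q n)%Z)).
  by rewrite !modz_dvd_mod // dvdzE /= dvdn_exp2l // leq_addl.
apply/dvdz_mod0P/eqP; first by rewrite -e residue_mod.
by move=> x0; rewrite -e x0 mod0z.
Qed.

Lemma padic_integral : GRing.integral_domain_axiom Zp.
Proof.
move=> x y xy0; apply/norP => -[nx ny].
have nz z : z != 0 -> exists n, z n != 0.
  move=> z0; apply: contrapT => hz; case/eqP: z0; apply: padicZ_ext => n /=.
  by rewrite mod0z; apply/eqP/negPn/negP => zn; apply: hz; exists n.
have [[a xa] [b yb]] := (nz x nx, nz y ny).
have := congr1 (fun z : Zp => z (b + a)%N) xy0; rewrite /= mod0z.
move/dvdz_mod0P; move: xa yb; rewrite -(residue_dvd x a b) -(residue_dvd y b a).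
rewrite (addnC a b) !dvdzE abszM /=.
move: `|x (b + a)%N|%N `|y (b + a)%N|%N => m n xa yb.
have m0: (0 < m)%N by case: m xa => //; rewrite dvdn0.
have n0: (0 < n)%N by case: n yb => //; rewrite dvdn0.
move: xa yb; rewrite !pfactor_dvdn ?muln_gt0 ?m0 ?n0 // lognM // -!ltnNge.
by move=> xa yb; apply/negP; rewrite -ltnNge addnC -addnS leq_add // ltnW.
Qed.

HB.instance Definition _ := GRing.ComUnitRing_isIntegral.Build Zp padic_integral.

Lemma residue_int (a : int) n : (a%:~R : Zp) n = (a %% q n)%Z.
Proof.
have nat_case (k : nat) : (k%:R : Zp) n = (k%:Z %% q n)%Z.
  elim: k => [|k IHk]; first by [].
  by rewrite -natr1 [LHS]/= IHk /= modzDm addrC -intS.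
case: a => k; first exact: nat_case.
rewrite NegzE mulrNz [LHS]/= -modzNm.
by rewrite -[_.+1%:~R]/(_.+1%:R) nat_case !modzNm.
Qed.

Lemma padicZ_intr_eq0 (a : int) : ((a%:~R : Zp) == 0) = (a == 0).
Proof.
apply/eqP/eqP => [a0|->//].
have := residue_int a `|a|; rewrite a0 /= mod0z => /esym/dvdz_mod0P.
rewrite dvdzE /= => le; apply/eqP; rewrite -absz_eq0; apply/negPn/negP.
rewrite -lt0n => /dvdn_leq/(_ le); rewrite leqNgt.
by rewrite ltn_expl ?prime_gt1.
Qed.

End PadicIntegers.

Definition padicQ (p : nat) (p_pr : prime p) : fieldType :=
  {fraction (padicZ p_pr)}.

Section Ratr.
Variables (p : nat) (p_pr : prime p).
Local Notation Qp := (padicQ p_pr).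

Lemma padicQ_intr_eq0 (a : int) : ((a%:~R : Qp) == 0) = (a == 0).
Proof.
by rewrite -(rmorph_int (@tofrac (padicZ p_pr))) tofrac_eq0 padicZ_intr_eq0.
Qed.

Lemma ratr_padic_frac (x : rat) (a b : int) : b != 0 ->
  x * b%:~R = a%:~R -> (ratr x : Qp) = a%:~R / b%:~R.
Proof.
move=> b0 xb; apply/eqP.
rewrite eqr_div ?padicQ_intr_eq0 ?denq_neq0 // -!intrM; apply/eqP.
congr (_%:~R); apply/(@intr_inj rat).
by rewrite !intrM -xb numqE mulrAC.
Qed.

Lemma ratr_padicD (x y : rat) : (ratr (x + y) : Qp) = ratr x + ratr y.
Proof.
rewrite (@ratr_padic_frac _ (numq x * denq y + numq y * denq x)
           (denq x * denq y)) ?mulf_neq0 ?denq_neq0 //.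
  by rewrite /ratr addf_div ?padicQ_intr_eq0 ?denq_neq0 // rmorphD !rmorphM.
by rewrite rmorphD !rmorphM /= !numqE mulrDl !mulrA (mulrAC y).
Qed.
End Ratr.

Section UnitRootFactor.
Variables (p : nat) (p_pr : prime p).
Local Notation Zp := (padicZ p_pr).
Local Notation Qp := (padicQ p_pr).

Definition padicZ_to (K : fieldExtType Qp) : Zp -> K :=
  in_alg K \o @tofrac Zp.
HB.instance Definition _ (K : fieldExtType Qp) :=
  GRing.RMorphism.copy (@padicZ_to K) (in_alg K \o @tofrac Zp).

Variable K : fieldExtType Qp.
Implicit Types (x z pi : K) (f : {poly Zp}).

Definition is_splitting_field f :=
  splittingFieldFor 1%VS (map_poly (@padicZ_to K) f) fullv.

(* The integral closure of Z_p in K. *)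
Definition ring_of_integers : set K := [set x | integralOver (@padicZ_to K) x].

Definition integer_units : set K :=
  [set x | [/\ x != 0, ring_of_integers x & ring_of_integers x^-1]].

(* pi generates the maximal ideal (the non-units) of the ring of integers. *)
Definition uniformizer pi := pi != 0 /\
  ring_of_integers `\` integer_units = [set pi * y | y in ring_of_integers].

(* |u pi^n|_pi = c^n for u a unit, and |0|_pi = 0.  The real number c = |pi|_pi
   in (0, 1) is the normalization of the absolute value. *)
Definition absv (R : realType) (c : R) pi x : R :=
  xget 0 [set a | exists (n : int) (u : K),
                    [/\ integer_units u, x = u * pi ^ n & a = c ^ n]].

(* The roots with multiplicity: the list is unique up to order when f is monic
   and splits over K. *)
Definition roots_of f : seq K :=
  xget [::] [set s | map_poly (@padicZ_to K) f = \prod_(z <- s) ('X - z%:P)].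

(* The coefficients of this polynomial are in fact in Q_p, but it is built, and
   used, as a polynomial over K. *)
Definition unit_root_factor (R : realType) (c : R) pi f : {poly K} :=
  \prod_(z <- roots_of f | absv c pi z == 1) ('X - z%:P).
End UnitRootFactor.

Section Dual.
Variables (p : nat) (p_pr : prime p) (r : nat).
Local Notation Zp := (padicZ p_pr).
Local Notation Qp := (padicQ p_pr).
Implicit Types (G : set 'cV[rat]_r) (w : 'rV[Zp]_r) (g : 'cV[rat]_r).

Definition row_app w g : Qp :=
  (map_mx (@tofrac Zp) w *m map_mx ratr g) 0 0.

(* Additivity is stated through val: the subset G carries no group structure as
   a type. *)
Definition is_hom G (phi : G -> Zp) :=
  forall x y z : G, val z = val x + val y -> phi z = phi x + phi y.

(* Hom(G, Z_p), a homomorphism being identified with the row that represents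
   it. *)
Definition padic_dual G : set 'rV[Zp]_r :=
  [set w | exists2 phi : G -> Zp, is_hom phi &
             forall g : G, tofrac (phi g) = row_app w (val g)].

Lemma padic_dualP G w : padic_dual G w <->
  forall g, G g -> exists z : Zp, row_app w g = tofrac z.
Proof.
split=> [[phi _ phiE] g Gg|wG].
  by exists (phi (exist _ g (mem_set Gg))); rewrite phiE.
have phiP (g : G) : exists z : Zp, row_app w (val g) = tofrac z.
  by apply: wG; apply: set_mem; exact: valP g.
exists (fun g : G => projT1 (cid (phiP g))) => [x y z xyz|g]; last first.
  by case: cid.
case: cid => a; case: cid => b; case: cid => c /= hc hb ha.
apply/eqP; rewrite -tofrac_eq tofracD -ha -hb -hc xyz; apply/eqP.
rewrite /row_app !mxE -big_split; apply: eq_bigr => i _.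
by rewrite !mxE ratr_padicD mulrDr.
Qed.
End Dual.

(* The union of the A^-n (Z^r) in Q^r, for A of positive size r.+1. *)
Definition limit_group (r : nat) (A : 'M[int]_r.+1) : set 'cV[rat]_r.+1 :=
  \bigcup_(n in [set: nat])
    [set map_mx intr A ^- n *m map_mx intr z | z in [set: 'cV[int]_r.+1]].

(* Main.v *)
From HB Require Import structures.
Require Import Defs.
From mathcomp Require Import all_boot all_order all_algebra all_field.
From mathcomp Require Import boolp classical_sets reals.

Set Implicit Arguments.
Unset Strict Implicit.
Unset Printing Implicit Defensive.

Import Order.TTheory GRing.Theory Num.Theory.
Local Open Scope ring_scope.
Local Open Scope classical_set_scope.

(** Write B for A over Z_p, M for A over K, and O for the integral closure of
    Z_p in K.  Multiplying by B^n turns the condition that w A^-n z lie in Z_p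
    for all n and all integral z into the condition that, for each n, w = v B^n
    for some row v over Z_p; this is padic_dual_limit_groupP.  Call such a w
    infinitely divisible.  By absv_eq1, the roots of absolute value 1 are the
    roots that are units of O, so the characteristic polynomial of A factors
    over K as g h, where g is the unit root factor and no root of h is a unit.

    Suppose that w is infinitely divisible, w = v_n B^n.  The module of rows
    over Z_p is Noetherian, so some v_n is a combination of v_0, ..., v_(n-1)
    (padic_row_dependence), and multiplication by B^n turns this relation into
    w q(B) = 0 with q = 1 - X k and k over Z_p (divisible_row_annihilator).  A
    root z of q satisfies z k(z) = 1, so if it lies in O it is a unit of O:
    hence q and h have no common root (coprime_nonunit_roots).  As w g(M) is
    annihilated by q(M), and by h(M) by the theorem of Cayley and Hamilton, it
    is zero (annihilator_coprime_cofactor).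

    Suppose now that w g(M) = 0.  The roots of g, hence its constant term, are
    units of O, so this relation can be solved for w as v M with v integral
    over Z_p (integral_row_divisible).  The row v = w M^-1 has entries in Q_p,
    and Z_p is integrally closed (padic_integrally_closed), so v is a row over
    Z_p.  Since M is invertible, v g(M) = 0 as well, and the argument can be
    repeated (divisible_row_step).

    Both finiteness and integral closure come from the existence, in any
    sequence of p-adic integers, of a term that divides all the others
    (padic_min_valuation). *)

(** * Divisibility in the p-adic integers *)

Section PadicArithmetic.
Variables (p : nat) (p_pr : prime p).
Local Notation Zp := (padicZ p_pr).
Local Notation q n := ((p ^ n)%N%:Z).
Implicit Types (x y : Zp) (m n : nat).

Lemma q_neq0 n : q n != 0.
Proof. by rewrite eqz_nat -lt0n expn_gt0 prime_gt0. Qed.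

Lemma residue_addn x m n : (x (m + n)%N = x n %[mod q n])%Z.
Proof.
elim: m => //= m <-; have := residue_modS x (m + n).
move/(congr1 (fun a => (a %% q n)%Z)).
by rewrite !modz_dvd_mod // dvdzE /= dvdn_exp2l // leq_addl.
Qed.

Lemma residue0 x : x 0%N = 0.
Proof. by rewrite -[LHS]residue_mod expn0 modz1. Qed.

(** The residues of x at positive levels are prime to p, so the one modulo p^n
    has an inverse u n modulo p^n, and these inverses are compatible because inverses are unique. *)
Lemma padic_inverse x : x 1%N != 0 -> exists y, y * x = 1.
Proof.
move=> x1.
have cop n : coprimez (x n) (q n).
  rewrite coprimezE /=; case: n => [|n]; first by rewrite expn0 coprimen1.
  rewrite coprime_sym coprimeXl // prime_coprime //.
  have := residue_dvd x 1 n; rewrite expn1 dvdzE /= addn1 => ->.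
  exact: x1.
have inv n : {u : int | (u * x n = 1 %[mod q n])%Z}.
  have [u [v uv]] := Bezoutz (x n) (q n); exists u.
  move: (cop n); rewrite /coprimez -uv => /eqP <-.
  by rewrite addrC modzMDl.
pose u n := sval (inv n).
have uP n : (u n * x n = 1 %[mod q n])%Z by rewrite /u; case: (inv n).
have uS : reduce_spec p u.
  move=> n; have uSn : (u n.+1 * x n = 1 %[mod q n])%Z.
    rewrite -modzMmr (residue_modS x) modzMmr.
    by rewrite -(modz_dvd_mod _ (q_dvdS p n)) uP modz_dvd_mod ?q_dvdS.
  rewrite -[u n]mulr1 -modzMmr -uSn modzMmr mulrCA -modzMmr uP modzMmr.
  by rewrite mulr1.
exists (reduce p_pr uS); apply: padicZ_ext => n /=.
by rewrite modzMml uP.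
Qed.

(** The residue of the quotient modulo p^m is read off the residue of x modulo
    p^(m + n). *)
Lemma padic_divq x n : x n = 0 -> exists y, x = y * (q n)%:~R.
Proof.
move=> xn0.
have dv m : (q n %| x (m + n)%N)%Z by rewrite residue_dvd xn0.
have uS : reduce_spec p (fun m => (x (m + n)%N %/ q n)%Z).
  move=> m; apply/eqP; rewrite eqz_mod_dvd.
  have := residue_modS x (m + n) => /eqP; rewrite eqz_mod_dvd.
  rewrite -(@dvdz_mul2r (q n) (q m)) ?q_neq0 //.
  by rewrite mulrBl !divzK ?dv // -?addSn // expnD PoszM.
exists (reduce p_pr uS); apply: padicZ_ext => m /=.
rewrite residue_int modzMml modzMmr divzK ?dv //.
by rewrite addnC residue_addn residue_mod.
Qed.

(** If n.+1 is the least level at which some term has a nonzero residue, then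
    p^n divides every term, and at that level one of the terms is p^n times an
    element that is invertible. *)
Lemma padic_min_valuation (a : nat -> Zp) :
  exists i, forall j, exists c, a j = c * a i.
Proof.
have [all0|] := pselect (forall j, a j = 0).
  by exists 0%N => j; exists 0; rewrite mul0r.
move/existsNP=> [j0 aj0].
have ex : exists n, `[< exists j, a j n != 0 >].
  apply: contrapT => nex; apply: aj0; apply: padicZ_ext => n /=.
  rewrite mod0z; apply/eqP/negPn/negP => an; apply: nex.
  by exists n; apply/asboolP; exists j0.
case: (ex_minnP ex) => n /asboolP [i ain] nmin.
case: n => [|n] in ain nmin; first by rewrite residue0 in ain.
have a0 j : a j n = 0.
  apply/eqP/negPn/negP => ajn; suff: (n < n)%N by rewrite ltnn.
  by apply: nmin; apply/asboolP; exists j.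
have [y yE] := padic_divq (a0 i).
have /padic_inverse [z zy] : y 1%N != 0.
  apply: contra_neq ain => /padic_divq [t tE].
  rewrite yE tE -mulrA -intrM -PoszM expn1 -expnS /= residue_int.
  by rewrite modzMmr modzMl.
exists i => j; have [yj yjE] := padic_divq (a0 j).
by exists (yj * z); rewrite yE yjE -!mulrA (mulrA z) zy mul1r.
Qed.

Lemma padic_valuation_ring x y :
  (exists c, x = c * y) \/ (exists c, y = c * x).
Proof.
have [[|i] iP] := padic_min_valuation (fun n => if n is 0%N then x else y).
  by right; apply: (iP 1%N).
by left; apply: (iP 0%N).
Qed.
End PadicArithmetic.

(** * Noetherianity of the rows over the p-adic integers *)

Section FinitelyGenerated.
Variables (p : nat) (p_pr : prime p) (r : nat).
Local Notation Zp := (padicZ p_pr).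

(** This is the ascending chain condition for the submodules spanned by initial
    segments of v.  It is proved by elimination, on the number k of leading
    coordinates that may be nonzero: a term whose last such coordinate divides
    that of all the others serves as pivot, and the terms that follow it,
    reduced by the pivot, have only k - 1 such coordinates. *)
Lemma padic_row_dependence (v : nat -> 'rV[Zp]_r) :
  exists n (c : nat -> Zp), v n = \sum_(j < n) c j *: v j.
Proof.
suff main k : forall v : nat -> 'rV[Zp]_r,
    (forall (j : nat) (i : 'I_r), (k <= i)%N -> v j 0 i = 0) ->
  exists n (c : nat -> Zp), v n = \sum_(j < n) c j *: v j.
  by apply: (main r) => j i; rewrite leqNgt ltn_ord.
elim: k {v} => [|k IHk] v v0.
  exists 0%N, (fun=> 0); rewrite big_ord0; apply/rowP => i.
  by rewrite mxE v0.
have [k_lt_r|r_le_k] := ltnP k r; last first.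
  apply: IHk => j i; rewrite leqNgt.
  by rewrite (leq_trans (ltn_ord i) r_le_k).
pose ik := Ordinal k_lt_r.
have [j0 j0P] := padic_min_valuation (fun j => v j 0 ik).
have [b bE] := choice j0P.
pose t j := (j0.+1 + j)%N.
have [|n [d dE]] := IHk (fun j => v (t j) - b (t j) *: v j0).
  move=> j i; rewrite leq_eqVlt !mxE => /predU1P[ki|/v0 v0i].
    by have -> : i = ik; [apply: val_inj | rewrite bE subrr].
  by rewrite !v0i mulr0 subr0.
(* The coefficient of the pivot collects what the reductions subtracted. *)
pose e i := if (i < j0)%N then 0 else
  if i == j0 then b (t n) - \sum_(j < n) d j * b (t j) else d (i - j0.+1)%N.
exists (t n), e; rewrite big_split_ord /= big_ord_recr /=.
rewrite big1 => [|i _]; last by rewrite /e ltn_ord scale0r.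
rewrite {1}/e ltnn eqxx add0r.
under eq_bigr => i _.
  rewrite /e addSn ltnNge ltnW ?ltnS ?leq_addr //= gtn_eqF ?ltnS ?leq_addr //.
  rewrite -addSn addKn; over.
rewrite -[LHS](subrK (b (t n) *: v j0)) dE.
rewrite scalerBl scaler_suml [LHS]addrC -[RHS]addrA; congr (_ + _).
rewrite -sumrN -big_split; apply: eq_bigr => i _ /=.
by rewrite scalerBr scalerA [RHS]addrC.
Qed.
End FinitelyGenerated.

(** * Integral closure of the p-adic integers *)

Lemma fraction_div (D : idomainType) (x : {fraction D}) :
  exists a, exists2 b : D, b != 0 & x = tofrac a / tofrac b.
Proof.
elim/quotW: x => x; exists (frac x).1, (frac x).2; first exact: denom_ratioP.
apply: (canRL (mulfK _)); first by rewrite tofrac_eq0 denom_ratioP.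
rewrite [LHS]piE; unlock tofrac; apply/eqmodP.
rewrite /= FracField.equivfE /FracField.mulf.
rewrite !numden_Ratio ?mulf_neq0 ?denom_ratioP ?oner_neq0 //.
have D_mulr1 (a : D) : a * 1 = a by exact: mulr1.
by rewrite !D_mulr1; apply/eqP; exact: mulrC.
Qed.

Section IntegrallyClosed.
Variables (p : nat) (p_pr : prime p).
Local Notation Zp := (padicZ p_pr).
Local Notation Qp := (padicQ p_pr).

(** If the inverse of x is the image of c in Z_p, an equation
    x^(m+1) = - (f_0 + ... + f_m x^m) multiplied by c^m expresses x as a
    polynomial in c. *)
Lemma padic_integrally_closed (x : Qp) :
  integralOver (@tofrac Zp) x -> exists a, x = tofrac a.
Proof.
move=> [f f_monic fx0].
have [a [b b0 xE]] := fraction_div x.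
have bF0 : tofrac b != 0 :> Qp by rewrite tofrac_eq0.
have [[c ac]|[c bc]] := padic_valuation_ring a b.
  by exists c; rewrite xE ac tofracM mulfK.
have xc : x * tofrac c = 1.
  rewrite xE mulrAC -tofracM mulrC [a * c]mulrC -bc mulVf //.
have [m fm] : exists m, size f = m.+2.
  case sz: (size f) => [|[|m]]; last by exists m.
    by move/eqP: sz; rewrite size_poly_eq0 (negPf (monic_neq0 f_monic)).
  move: fx0; rewrite (size1_polyC (eq_leq sz)).
  have -> : f`_0 = 1 by move/monicP: f_monic; rewrite lead_coefE sz.
  by rewrite map_polyC /= rootC tofrac1 oner_eq0.
exists (- \sum_(i < m.+1) f`_i * c ^+ (m - i)).
move: fx0 => /rootP; rewrite horner_coef size_map_poly_id0; last first.
  by rewrite (monicP f_monic) tofrac_eq0 oner_eq0.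
rewrite fm big_ord_recr /= !coef_map /= -[f`_m.+1]/(f`_(m.+2.-1)) -fm.
rewrite -/(lead_coef f) (monicP f_monic) rmorph1 mul1r => /eqP.
rewrite addrC addr_eq0 => /eqP fx.
rewrite -[x]mulr1 -(expr1n _ m) -xc exprMn mulrA -exprS fx.
rewrite mulNr rmorphN /= rmorph_sum mulr_suml; congr (- _).
apply: eq_bigr => i _; rewrite coef_map rmorphM rmorphXn -mulrA; congr (_ * _).
have -> : tofrac c ^+ m = tofrac c ^+ i * tofrac c ^+ (m - i) :> Qp.
  by rewrite -exprD subnKC // -ltnS.
by rewrite mulrA -exprMn xc expr1n mul1r.
Qed.
End IntegrallyClosed.

(** * Description of the dual by divisibility of rows *)

Section InvertiblePowers.
Variables (R : comUnitRingType) (m r : nat).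
Implicit Types (C : 'M[R]_r.+1) (w : 'M[R]_(m, r.+1)).

Lemma mulmx_expKV C n w : C \in unitmx -> w *m C ^- n *m C ^+ n = w.
Proof. by move=> C_unit; apply: mulmxKV; exact: unitrX. Qed.

Lemma mulmx_expK C n w : C \in unitmx -> w *m C ^+ n *m C ^- n = w.
Proof. by move=> C_unit; apply: mulmxK; exact: unitrX. Qed.
End InvertiblePowers.

Section DualOfLimitGroup.
Variables (p : nat) (p_pr : prime p).
Local Notation Zp := (padicZ p_pr).
Local Notation Qp := (padicQ p_pr).

(** The function ratr is canonically a morphism only when its values are in a
    number field; this alias carries the morphism structure for Q_p. *)
Definition rat_padic : rat -> Qp := ratr.

Lemma rat_padic_is_zmod_morphism : zmod_morphism rat_padic.
Proof.
move=> x y; apply: (canRL (addrK _)).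
by rewrite /rat_padic -ratr_padicD subrK.
Qed.

Lemma rat_padic_is_monoid_morphism : monoid_morphism rat_padic.
Proof.
split=> [|x y]; first by rewrite /rat_padic (@ratr_padic_frac _ _ 1 1 1) ?divr1.
rewrite /rat_padic (@ratr_padic_frac _ _ _ (numq x * numq y)
  (denq x * denq y)) ?mulf_neq0 ?denq_neq0 //.
  by rewrite /ratr !intrM mulf_div.
by rewrite !intrM !numqE mulrACA.
Qed.

HB.instance Definition _ := GRing.isZmodMorphism.Build rat Qp rat_padic
  rat_padic_is_zmod_morphism.
HB.instance Definition _ := GRing.isMonoidMorphism.Build rat Qp rat_padic
  rat_padic_is_monoid_morphism.

Lemma map_mx_tofrac_inj m n :
  injective (map_mx (@tofrac Zp) : 'M[Zp]_(m, n) -> 'M[Qp]_(m, n)).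
Proof.
move=> M N MN; apply/matrixP => i j; apply/eqP; rewrite -tofrac_eq.
by move/matrixP/(_ i j): MN; rewrite !mxE => ->.
Qed.

Lemma map_mx_tofrac_unit r (B : 'M[Zp]_r.+1) :
  \det B != 0 -> map_mx (@tofrac Zp) B \in unitmx.
Proof. by move=> B0; rewrite unitmxE det_map_mx unitfE tofrac_eq0. Qed.

Lemma map_mx_intr (R S : nzRingType) (f : {rmorphism R -> S}) m n
    (M : 'M[int]_(m, n)) :
  map_mx f (map_mx intr M) = map_mx intr M.
Proof. by apply/matrixP => i j; rewrite !mxE rmorph_int. Qed.

(** The values of w on A^-n (Z^r) are p-adic integers as soon as those on the
    images of the standard basis are, and these are the entries of w A^-n. *)
Lemma padic_dual_limit_groupP r (A : 'M[int]_r.+1) (w : 'rV[Zp]_r.+1) :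
  \det A != 0 ->
  padic_dual (limit_group A) w <->
  forall n, exists v : 'rV[Zp]_r.+1, w = v *m map_mx intr A ^+ n.
Proof.
move=> A0; set B : 'M[Zp]_r.+1 := map_mx intr A.
pose C := map_mx (@tofrac Zp) B.
have C_unit : C \in unitmx.
  by rewrite map_mx_tofrac_unit // (det_map_mx intr) padicZ_intr_eq0.
have row_appE n (z : 'cV[int]_r.+1) :
  row_app w (map_mx intr A ^- n *m map_mx intr z) =
  (map_mx (@tofrac Zp) w *m C ^- n *m map_mx intr z) 0 0.
  rewrite /row_app -[ratr]/rat_padic map_mxM map_mx_inv rmorphXn /=.
  by rewrite !map_mx_intr mulmxA /C /B map_mx_intr.
rewrite padic_dualP; split=> [wG n|wB g [n _ [z _ <-]]].
  have entry j : exists a, (map_mx (@tofrac Zp) w *m C ^- n) 0 j = tofrac a.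
    have [|a aE] := wG (map_mx intr A ^- n *m map_mx intr (delta_mx j 0)).
      by exists n => //; exists (delta_mx j 0).
    by exists a; rewrite -aE row_appE map_delta_mx -colE [RHS]mxE.
  have [v vE] := choice entry.
  exists (\row_j v j); apply: map_mx_tofrac_inj.
  have vC : map_mx (@tofrac Zp) (\row_j v j) = map_mx (@tofrac Zp) w *m C ^- n.
    by apply/rowP => j; rewrite vE !mxE.
  by rewrite map_mxM vC rmorphXn /= mulmx_expKV.
have [v wE] := wB n; exists ((v *m map_mx intr z) 0 0).
rewrite row_appE wE map_mxM rmorphXn /= mulmx_expK //.
by rewrite -(map_mx_intr (@tofrac Zp) z) -map_mxM mxE.
Qed.
End DualOfLimitGroup.

(** * Roots of absolute value 1 *)

Section UnitRoots.
Variables (p : nat) (p_pr : prime p) (K : fieldExtType (padicQ p_pr)).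
Local Notation Zp := (padicZ p_pr).
Local Notation iota := (@padicZ_to p p_pr K).

Lemma integer_unitsM (x y : K) :
  integer_units x -> integer_units y -> integer_units (x * y).
Proof.
move=> [x0 Ox Ox'] [y0 Oy Oy']; split; first by rewrite mulf_neq0.
  exact: integral_mul.
by rewrite invfM; exact: integral_mul.
Qed.

Lemma integer_unitsV (x : K) : integer_units x -> integer_units x^-1.
Proof. by move=> [x0 Ox Ox']; split; rewrite ?invr_eq0 ?invrK. Qed.

(** Every positive power of pi lies in pi O, which contains no unit. *)
Lemma uniformizer_exp_unit (pi : K) (n : int) :
  uniformizer pi -> integer_units (pi ^ n) -> n = 0.
Proof.
move=> [pi0 piE].
have nonunit y : ring_of_integers y -> ~ integer_units (pi * y).
  move=> Oy; have : [set pi * y | y in @ring_of_integers p p_pr K] (pi * y).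
    by exists y.
  by rewrite -piE => -[].
have O_pi : ring_of_integers pi.
  have : [set pi * y | y in @ring_of_integers p p_pr K] (pi * 1).
    by exists 1 => //; exact: integral1.
  by rewrite -piE mulr1 => -[].
have O_exp k : ring_of_integers (pi ^+ k).
  elim: k => [|k IHk]; first exact: integral1.
  by rewrite exprS; exact: integral_mul.
case: n => [[|k] //|k]; rewrite ?NegzE -?exprnP ?exprS.
  by move/nonunit => /(_ (O_exp k)).
by move/integer_unitsV; rewrite -exprnN invrK exprS => /(nonunit _ (O_exp k)).
Qed.

(** The absolute value is 1 exactly when the exponent n in z = u pi^n is 0.
    The exponent is unique because no nonzero power of pi is a unit.  A unit is
    its own u with n = 0, and an element that has no exponent has the default
    absolute value 0. *)
Lemma absv_eq1 (R : realType) (c : R) (pi z : K) :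
  0 < c < 1 -> uniformizer pi -> (absv c pi z == 1) = `[< integer_units z >].
Proof.
move=> /andP[c0 c1] unif_pi; rewrite /absv; apply/eqP/asboolP => [|Uz].
  case: xgetP => [a _ [n [u [Uu -> ->]]] /eqP|_ /esym/eqP]; last first.
    by rewrite oner_eq0.
  rewrite pexprz_eq1 ?ltW // (lt_eqF c1) orbF => /eqP ->.
  by rewrite expr0z mulr1.
case: xgetP => [a _ [n [u [Uu zE ->]]]|/(_ 1)]; last first.
  by case; exists 0, z; rewrite !expr0z mulr1.
suff -> : n = 0 by rewrite expr0z.
apply: uniformizer_exp_unit unif_pi _.
have -> : pi ^ n = u^-1 * z by rewrite zE mulKf //; case: Uu.
by apply: integer_unitsM => //; exact: integer_unitsV.
Qed.

Lemma roots_ofE (f : {poly Zp}) : f \is monic -> is_splitting_field K f ->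
  map_poly iota f = \prod_(z <- roots_of K f) ('X - z%:P).
Proof.
move=> f_monic [s fs _]; rewrite /roots_of; case: xgetP => // /(_ s) [].
by apply/eqP; rewrite -eqp_monic ?monic_map ?monic_prod_XsubC.
Qed.

Lemma integer_integral_coef (k : {poly Zp}) :
  {in map_poly iota k : seq K, integralRange iota}.
Proof.
by apply/integral_poly => i; rewrite coef_map; exact: integral_id.
Qed.

(** A root z of 1 - X k has k(z) as its inverse, and k(z) is integral if z
    is. *)
Lemma coprime_nonunit_roots (k : {poly Zp}) (s : seq K) (P : pred K) :
    (forall z, z \in s -> ring_of_integers z) ->
    (forall z, z \in s -> integer_units z -> ~~ P z) ->
  coprimep (map_poly iota (1 - 'X * k)) (\prod_(z <- s | P z) ('X - z%:P)).
Proof.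
move=> Os sP; rewrite big_seq_cond.
apply: (big_ind (coprimep _)) => [|f g fP gP|z /andP[zs Pz]].
- exact: coprimep1.
- by rewrite coprimepMr fP.
rewrite coprimep_XsubC; apply: contraTN Pz => /rootP.
rewrite rmorphB rmorph1 rmorphM /= map_polyX !hornerE => /eqP.
rewrite subr_eq0 => /eqP zk.
have z0 : z != 0 by apply: contra_eq_neq zk => ->; rewrite mul0r oner_eq0.
apply: sP => //; split=> //; first exact: Os.
have -> : z^-1 = (map_poly iota k).[z] by apply: (mulfI z0); rewrite mulfV.
by apply: integral_horner (Os _ zs); exact: integer_integral_coef.
Qed.
End UnitRoots.

(** * Infinitely divisible rows are annihilated by the unit root factor *)

(** With a q + b h = 1, the polynomial g is the sum of a multiple of q and of a
    multiple of the characteristic polynomial g h. *)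
Lemma annihilator_coprime_cofactor (F : fieldType) r (M : 'M[F]_r.+1)
    (w : 'rV[F]_r.+1) (q g h : {poly F}) :
    w *m horner_mx M q = 0 -> char_poly M = g * h -> coprimep q h ->
  w *m horner_mx M g = 0.
Proof.
move=> wq chiE /Bezout_eq1_coprimepP[[a b] /= ab1].
have -> : g = q * (a * g) + char_poly M * b.
  rewrite chiE -[LHS]mulr1 -ab1 mulrDr; congr (_ + _).
    by rewrite [RHS]mulrC mulrA (mulrC g).
  by rewrite -mulrA (mulrC h).
rewrite rmorphD !rmorphM /= Cayley_Hamilton mul0r addr0.
by rewrite -[_ * _]/(_ *m _) mulmxA wq mul0mx.
Qed.

(** From v_n = c_0 v_0 + ... + c_(n-1) v_(n-1) and v_j B^n = w B^(n-j), one gets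
    w = c_0 w B^n + ... + c_(n-1) w B, where B occurs with positive exponents
    only. *)
Lemma divisible_row_annihilator p (p_pr : prime p) r (B : 'M[padicZ p_pr]_r.+1)
    (w : 'rV[padicZ p_pr]_r.+1) :
  (forall n, exists v : 'rV_r.+1, w = v *m B ^+ n) ->
  exists k, w *m horner_mx B (1 - 'X * k) = 0.
Proof.
move=> /choice[v vE]; have [n [c vn]] := padic_row_dependence v.
exists (\sum_(j < n) c j *: 'X^((n - j).-1)).
rewrite rmorphB rmorph1 rmorphM rmorph_sum /= horner_mx_X mulmxBr mulmx1.
apply/eqP; rewrite subr_eq0 {1}(vE n) vn; apply/eqP.
rewrite mulr_sumr mulmx_sumr mulmx_suml; apply: eq_bigr => j _.
rewrite linearZ rmorphXn /= horner_mx_X -scalerAr -exprS.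
rewrite prednK ?subn_gt0 // -scalemxAr -scalemxAl; congr (_ *: _).
rewrite (vE j) -mulmxA; congr (_ *m _).
by rewrite -[RHS]/(B ^+ j * B ^+ (n - j)) -exprD subnKC // ltnW.
Qed.

(** * Rows annihilated by the unit root factor are infinitely divisible *)

Section Integrality.
Variables (p : nat) (p_pr : prime p) (K : fieldExtType (padicQ p_pr)).
Local Notation Zp := (padicZ p_pr).
Local Notation iota := (@padicZ_to p p_pr K).
Variables (r : nat) (B : 'M[Zp]_r.+1).
Let M := map_mx iota B.

(** Peeling off one root z at a time: if w (M - z) = v' M with v' integral, then
    w z = (w - v') M, and z can be divided out since it is a unit of O. *)
Lemma integral_row_divisible (s : seq K) (w : 'rV[K]_r.+1) :
    {in s, forall z, integer_units z} ->
    (forall j, integralOver iota (w 0 j)) ->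
    w *m horner_mx M (\prod_(z <- s) ('X - z%:P)) = 0 ->
  exists2 v : 'rV[K]_r.+1, forall j, integralOver iota (v 0 j) & w = v *m M.
Proof.
elim: s w => [|z s IHs] w Us Ow.
  rewrite big_nil rmorph1 mulmx1 => ->.
  by exists 0; rewrite ?mul0mx // => j; rewrite mxE; exact: integral0.
rewrite big_cons rmorphM rmorphB /= horner_mx_X horner_mx_C.
rewrite -[_ * _]/(_ *m _) mulmxA => ws.
have [z0 Oz Oz'] : integer_units z by apply: Us; rewrite mem_head.
have [|j|v' Ov' v'E] := IHs _ _ _ ws.
- by move=> y ys; apply: Us; rewrite inE ys orbT.
- rewrite mulmxBr mul_mx_scalar !mxE.
  apply: integral_sub; last exact: integral_mul.
  apply: (big_ind (integralOver iota)) => [||i _].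
  + exact: integral0.
  + by move=> a b; exact: integral_add.
  by rewrite !mxE; apply: integral_mul => //; exact: integral_id.
exists (z^-1 *: (w - v')) => [j|].
  by rewrite !mxE; apply: integral_mul => //; exact: integral_sub.
rewrite -scalemxAl mulmxBl -v'E mulmxBr mul_mx_scalar opprB addrC subrK.
by rewrite scalerA mulVf // scale1r.
Qed.

Lemma padicZ_to_eq0 (a : Zp) : (iota a == 0) = (a == 0).
Proof. by rewrite scaler_eq0 oner_eq0 orbF tofrac_eq0. Qed.

Lemma map_mx_padicZ_to m n (N : 'M[Zp]_(m, n)) :
  map_mx iota N = map_mx (in_alg K) (map_mx (@tofrac Zp) N).
Proof. by apply/matrixP => i j; rewrite !mxE. Qed.

Lemma map_poly_padicZ_to (f : {poly Zp}) :
  map_poly iota f = map_poly (in_alg K) (map_poly (@tofrac Zp) f).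
Proof. exact: map_poly_comp. Qed.

(** The row u given by integral_row_divisible is w M^-1, so its entries are in
    Q_p as well as integral, hence in Z_p. *)
Lemma divisible_row_step (s : seq K) (w : 'rV[Zp]_r.+1) :
    \det B != 0 ->
    {in s, forall z, integer_units z} ->
    map_mx iota w *m horner_mx M (\prod_(z <- s) ('X - z%:P)) = 0 ->
  exists2 v : 'rV[Zp]_r.+1, w = v *m B &
    map_mx iota v *m horner_mx M (\prod_(z <- s) ('X - z%:P)) = 0.
Proof.
move=> detB Us ws.
have M_unit : M \in unitmx.
  by rewrite unitmxE det_map_mx unitfE padicZ_to_eq0.
have B_unit := map_mx_tofrac_unit detB.
have [j|u Ou uE] := integral_row_divisible Us _ ws.
  by rewrite mxE; exact: integral_id.
pose x := map_mx (@tofrac Zp) w *m invmx (map_mx (@tofrac Zp) B).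
have ux : map_mx (in_alg K) x = u.
  apply: (can_inj (mulmxK M_unit)).
  by rewrite -uE /M !map_mx_padicZ_to -map_mxM mulmxKV.
have entry j : exists a, x 0 j = tofrac a.
  apply: padic_integrally_closed.
  have [f f_monic] := Ou j; rewrite -ux mxE => fx; exists f => //.
  by move: fx; rewrite map_poly_padicZ_to fmorph_root.
have [v vE] := choice entry.
have xE : x = map_mx (@tofrac Zp) (\row_j v j).
  by apply/rowP => j; rewrite vE !mxE.
exists (\row_j v j).
  by apply: map_mx_tofrac_inj; rewrite map_mxM -xE mulmxKV.
rewrite map_mx_padicZ_to -xE ux.
apply: (can_inj (mulmxK M_unit)); rewrite mul0mx -mulmxA.
rewrite -[_ *m M]/(_ * M) -[X in _ *m (_ * X)]horner_mx_X -rmorphM mulrC rmorphM.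
by rewrite /= horner_mx_X -[M * _]/(M *m _) mulmxA -uE.
Qed.
End Integrality.

Theorem theorem4p9 (p : nat) (p_pr : prime p) (r : nat) (A : 'M[int]_r.+1)
    (detA : \det A != 0) (K : fieldExtType (padicQ p_pr))
    (splitK : is_splitting_field K (map_poly intr (char_poly A)))
    (pi : K) (unif_pi : uniformizer pi)
    (R : realType) (c : R) (c01 : 0 < c < 1) :
  padic_dual (limit_group A) =
    [set w : 'rV[padicZ p_pr]_r.+1 | map_mx (@padicZ_to p p_pr K) w *m
             horner_mx (map_mx intr A)
               (unit_root_factor c pi (map_poly intr (char_poly A))) = 0].
Proof.
set f := map_poly intr (char_poly A) in splitK *.
pose B : 'M[padicZ p_pr]_r.+1 := map_mx intr A.
have fE : f = char_poly B by rewrite /f map_char_poly.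
have f_monic : f \is monic by rewrite fE char_poly_monic.
have rootsE := roots_ofE f_monic splitK.
have chiE : char_poly (map_mx (@padicZ_to p p_pr K) B) =
    \prod_(z <- roots_of K f) ('X - z%:P).
  by rewrite -map_char_poly -fE.
have detB : \det B != 0 by rewrite (det_map_mx intr) padicZ_intr_eq0.
rewrite -(map_mx_intr (@padicZ_to p p_pr K)) -/B /unit_root_factor.
apply/predeqP => w; rewrite (padic_dual_limit_groupP w detA) -/B /=.
split=> [wB|].
  have [k wk] := divisible_row_annihilator wB.
  apply: (annihilator_coprime_cofactor
    (q := map_poly (@padicZ_to p p_pr K) (1 - 'X * k))).
  - by rewrite -map_horner_mx -map_mxM wk map_mx0.
  - by rewrite chiE (bigID (fun z => absv c pi z == 1)).
  apply: coprime_nonunit_roots => z zs.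
    by exists f => //; rewrite rootsE root_prod_XsubC.
  by rewrite (absv_eq1 _ c01 unif_pi) negbK => Uz; apply/asboolP.
rewrite -big_filter => ws n.
elim: n w ws => [|n IHn] w ws; first by exists w; rewrite expr0 mulmx1.
have [z|v -> /IHn[u ->]] := divisible_row_step detB _ ws.
  by rewrite mem_filter (absv_eq1 _ c01 unif_pi) => /andP[/asboolP].
by exists u; rewrite exprSr mulmxA.
Qed.
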